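(* Let $\Gamma$ be a uniform layered graph with unique minimal vertex, $n\ge2$, and let $L=\{b_1,\dots,b_{|V_n|}\}$ be a basis of $B_n$ such that for every $i$ and every vertex $a\in V_n$ with $a\notin\operatorname{span}\{b_1,\dots,b_{i-1}\}$ we have $\dim\kappa_{b_i}\ge\dim\kappa_a$. Then $L$ is an upper vertex-like basis of $B_n$.
   Context: A layered graph is a finite directed graph $\Gamma=(V,E)$ with $V=\bigsqcup_{i=0}^{N}V_i$ such that every edge from $V_i$ goes to $V_{i-1}$; $|v|=i$ for $v\in V_i$, $V_+=\bigsqcup_{i\ge1}V_i$, $V_{\ge k}=\bigsqcup_{i\ge k}V_i$, $S(v)=\{w:(v,w)\in E\}$, nonempty for $v\in V_+$, $|V_0|=1$. $\Gamma$ is uniform if for every $v\in V_{\ge2}$ the elements of $S(v)$ form a single class under the transitive closure of $w\approx u$ iff $S(w)\cap S(u)\ne\emptyset$. Over a field $\mathbb F$, $B(\Gamma)=T(V_+)/R_B$ with $R_B$ the two-sided ideal generated by $\{vw: v,w\in V_+,(v,w)\notin E\}\cup\{v\sum_{w\in S(v)}w: v\in V_{\ge2}\}$, doubly graded with $v_1\cdots v_m$ in bidegree $(m,\sum|v_i|)$; $B_n=\operatorname{span}V_n$ is the bidegree $(1,n)$ part. For $a\in B_n$, $\kappa_a=\ker(B_{n-1}\to B(\Gamma),b\mapsto ab)$. $B(\Gamma|_n)$ is the subalgebra generated by $\bigcup_{i=1}^nV_i$. A basis $L$ of $B_n$ is upper vertex-like if there is a doubly graded algebra automorphism of $B(\Gamma|_n)$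 fixing every vertex in $\bigcup_{i=1}^{n-1}V_i$ and mapping the set $V_n$ onto $L$. *)

(* Defs.v *)
From HB Require Import structures.
From mathcomp Require Import all_boot all_order all_algebra.
Set Implicit Arguments. Unset Strict Implicit. Unset Printing Implicit Defensive.
Import GRing.Theory.
Local Open Scope ring_scope.

Section LayeredGraphs.
Variables (V : finType) (lvl : V -> nat) (E : rel V).

Definition layered : Prop :=
  [/\ (forall v w, E v w -> lvl v = (lvl w).+1),
      (forall v, (0 < lvl v)%N -> exists w, E v w) &
      #|[pred v | lvl v == 0%N]| = 1%N ].

Definition approx (w u : V) : bool := [exists x, E w x && E u x].

Definition uniform : Prop :=
  forall v, (2 <= lvl v)%N -> forall w u, E v w -> E v u ->
    connect [rel x y | [&& E v x, E v y & approx x y]] w u.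
End LayeredGraphs.

(* The tensor algebra T(V_+) over F: elements are represented by formal
   finite linear combinations of words; two representatives are equal in
   T iff they have the same coefficient function [coef]. *)
Section Algebra.
Variables (F : fieldType) (V : finType) (lvl : V -> nat) (E : rel V).

Definition word := seq V.
Definition lin := seq (F * word).
Definition coef (x : lin) (w : word) : F := \sum_(p <- x | p.2 == w) p.1.
Definition scalel (c : F) (x : lin) : lin := [seq (c * p.1, p.2) | p <- x].
Definition mull (x y : lin) : lin := [seq (p.1 * q.1, p.2 ++ q.2) | p <- x, q <- y].
Definition oneL : lin := [:: (1, [::])].
Definition letter (v : V) : lin := [:: (1, [:: v])].
Definition posw (w : word) : bool := all (fun v => (0 < lvl v)%N) w.

Definition isRel (r : lin) : Prop :=
  (exists v w, [/\ (0 < lvl v)%N, (0 < lvl w)%N, ~~ E v w & r = [:: (1, [:: v; w])]])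
  \/ (exists v, (2 <= lvl v)%N /\ r = [seq (1, [:: v; w]) | w <- enum [pred w | E v w]]).

Definition inR (z : lin) : Prop :=
  exists s : seq (F * word * lin * word),
    (forall t, t \in s -> [/\ posw t.1.1.2, isRel t.1.2 & posw t.2]) /\
    coef z =1 coef (flatten [seq scalel t.1.1.1
                               (mull (mull [:: (1, t.1.1.2)] t.1.2) [:: (1, t.2)]) | t <- s]).

(* equality in B(Gamma) = T(V_+)/R_B *)
Definition equivB (x y : lin) : Prop := inR (x ++ scalel (-1) y).

(* representatives of elements of B(Gamma|_n): words in V_1 u ... u V_n *)
Definition lowl (n : nat) (x : lin) : bool :=
  all (fun p => all (fun v => (0 < lvl v)%N && (lvl v <= n)%N) p.2) x.

Definition homog (m k : nat) (x : lin) : bool :=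
  all (fun p => (size p.2 == m) && (sumn (map lvl p.2) == k)) x.

(* phi (acting on representatives) induces a doubly graded algebra
   automorphism of the subalgebra B(Gamma|_n) of B(Gamma). *)
Record graded_aut (n : nat) (phi : lin -> lin) : Prop := {
  ga_low : forall x, lowl n x -> lowl n (phi x);
  ga_wd : forall x y, lowl n x -> lowl n y -> equivB x y -> equivB (phi x) (phi y);
  ga_add : forall x y, lowl n x -> lowl n y -> equivB (phi (x ++ y)) (phi x ++ phi y);
  ga_scale : forall c x, lowl n x -> equivB (phi (scalel c x)) (scalel c (phi x));
  ga_mul : forall x y, lowl n x -> lowl n y -> equivB (phi (mull x y)) (mull (phi x) (phi y));
  ga_one : equivB (phi oneL) oneL;
  ga_graded : forall m k x, lowl n x -> homog m k x ->
                exists y, [/\ lowl n y, homog m k y & equivB (phi x) y];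
  ga_inj : forall x y, lowl n x -> lowl n y -> equivB (phi x) (phi y) -> equivB x y;
  ga_surj : forall y, lowl n y -> exists x, lowl n x /\ equivB (phi x) y }.

(* Elements of B_k = span V_k (bidegree (1,k)) are given by coefficient
   functions V -> F supported on V_k. *)
Definition linv (f : {ffun V -> F}) : lin := [seq (f v, [:: v]) | v <- enum V].
Definition inBk (k : nat) (f : {ffun V -> F}) : Prop := forall v, lvl v != k -> f v = 0.
Definition indicator (a : V) : {ffun V -> F} := [ffun v => (v == a)%:R].

Definition indep (d : nat) (fam : 'I_d -> {ffun V -> F}) : Prop :=
  forall c : 'I_d -> F, (forall v, \sum_(i < d) c i * fam i v = 0) -> forall i, c i = 0.

Definition kappa (n : nat) (a f : {ffun V -> F}) : Prop :=
  inBk n.-1 f /\ inR (mull (linv a) (linv f)).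

Definition kdim_ge (n : nat) (a a' : {ffun V -> F}) : Prop :=
  forall d (fam : 'I_d -> {ffun V -> F}),
    (forall i, kappa n a' (fam i)) -> indep fam ->
    exists fam' : 'I_d -> {ffun V -> F}, (forall i, kappa n a (fam' i)) /\ indep fam'.

Definition is_basis (n N : nat) (b : 'I_N -> {ffun V -> F}) : Prop :=
  [/\ forall i, inBk n (b i), indep b &
      forall f, inBk n f -> exists c : 'I_N -> F, forall v, f v = \sum_(i < N) c i * b i v].

(* f in span{b_j : j < i}  (0-indexed, i.e. span{b_1,...,b_{i}} ... b_{i-1} in 1-indexed) *)
Definition in_span_prefix (N : nat) (b : 'I_N -> {ffun V -> F}) (i : nat) (f : {ffun V -> F}) : Prop :=
  exists c : 'I_N -> F, forall v, f v = \sum_(j < N | (j < i)%N) c j * b j v.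

Definition upper_vertex_like (n N : nat) (b : 'I_N -> {ffun V -> F}) : Prop :=
  exists phi : lin -> lin,
    [/\ graded_aut n phi,
        (forall v, (0 < lvl v)%N -> (lvl v < n)%N -> equivB (phi (letter v)) (letter v)),
        (forall v, lvl v = n -> exists i, equivB (phi (letter v)) (linv (b i))) &
        (forall i, exists v, lvl v = n /\ equivB (phi (letter v)) (linv (b i)))].
End Algebra.

(* Main.v *)
Require Import Defs.
From HB Require Import structures.
From mathcomp Require Import all_boot all_order all_fingroup all_algebra.
Set Implicit Arguments. Unset Strict Implicit. Unset Printing Implicit Defensive.
Import GRing.Theory.
Local Open Scope ring_scope.

(** For [a] in [B_n], [a * g = 0] exactly when [g] is constant on [S(v)] for every
    vertex [v] in the support of [a]; so [kappa_a] is the intersection of the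
    [kappa_v] over that support.  Expanding the nonzero determinant of the matrix
    of [L] gives a bijection [s] with [s i] in the support of [b_i], whence
    [kappa_{b_i} <= kappa_{s i}].  Expanding the determinant of its inverse gives a
    bijection [t] such that [v] is not in the span of the [b_j] preceding
    [b_{t v}], whence [dim kappa_v <= dim kappa_{b_{t v}}] by hypothesis.  Summing
    dimensions forces [kappa_{b_i} = kappa_{s i}] for all [i].  Substituting
    [b_i] for the vertex [s i] then respects the defining relations, and so does
    the inverse substitution, because the inverse of an invertible matrix supported
    on a preorder is supported on the same preorder. *)

(** * Equality in the free algebra tested by linear functionals, and substitution of letters *)

Section FreeAlgebra.
Variables (F : fieldType) (V : finType).
Implicit Types (x y z : lin F V) (f : word V -> F) (u w : word V).

(** The linear extension of [f] from words to formal combinations. Testing against every [f] turns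
    identities between representatives into identities of finite sums, with products becoming nested
    sums. *)
Definition ev f x : F := \sum_(p <- x) p.1 * f p.2.

Definition eqT x y : Prop := forall f, ev f x = ev f y.

Lemma evE f x : ev f x = \sum_(p <- x) p.1 * f p.2. Proof. by []. Qed.

Lemma ev_nil f : ev f [::] = 0. Proof. by rewrite /ev big_nil. Qed.

Lemma ev_cons f p x : ev f (p :: x) = p.1 * f p.2 + ev f x.
Proof. by rewrite /ev big_cons. Qed.

Lemma ev1 f c w : ev f [:: (c, w)] = c * f w.
Proof. by rewrite ev_cons ev_nil addr0. Qed.

Lemma ev_cat f x y : ev f (x ++ y) = ev f x + ev f y.
Proof. by rewrite /ev big_cat. Qed.

Lemma ev_scale f c x : ev f (scalel c x) = c * ev f x.
Proof.
by rewrite /ev big_map mulr_sumr; apply: eq_bigr => p _; rewrite mulrA.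
Qed.

Lemma ev_map (I : Type) (s : seq I) (P : pred I) (g : I -> F) (k : I -> word V) f :
  ev f [seq (g i, k i) | i <- s & P i] = \sum_(i <- s | P i) g i * f (k i).
Proof. by rewrite /ev big_map big_filter. Qed.

Lemma ev_flatten f (s : seq (lin F V)) : ev f (flatten s) = \sum_(x <- s) ev f x.
Proof. by rewrite /ev big_flatten. Qed.

Lemma ev_mull f x y : ev f (mull x y) = ev (fun u => ev (fun w => f (u ++ w)) y) x.
Proof.
rewrite /ev /mull big_allpairs_dep /=; apply: eq_bigr => p _.
by rewrite mulr_sumr; apply: eq_bigr => q _; rewrite mulrA.
Qed.

Lemma eq_ev f g x : f =1 g -> ev f x = ev g x.
Proof. by move=> fg; apply: eq_bigr => p _; rewrite fg. Qed.

Lemma ev_sandwich f u w x :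
  ev f (mull (mull [:: (1, u)] x) [:: (1, w)]) = ev (fun a => f (u ++ a ++ w)) x.
Proof.
by rewrite !ev_mull ev1 mul1r; apply: eq_ev => a; rewrite ev1 mul1r catA.
Qed.

Lemma eq_in_ev f g x : (forall p, p \in x -> f p.2 = g p.2) -> ev f x = ev g x.
Proof. by move=> fg; apply: eq_big_seq => p px; rewrite fg. Qed.

Lemma coef_ev x w : coef x w = ev (fun u => (u == w)%:R) x.
Proof.
rewrite /coef big_mkcond; apply: eq_bigr => p _.
by case: (p.2 == w); rewrite ?mulr1 ?mulr0.
Qed.

Lemma ev_coef f x (W : seq (word V)) : uniq W -> {subset map snd x <= W} ->
  ev f x = \sum_(w <- W) coef x w * f w.
Proof.
move=> uW sub; rewrite /coef; under eq_bigr => w _ do rewrite big_mkcond mulr_suml.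
rewrite exchange_big /= /ev !big_seq; apply: eq_bigr => p px.
rewrite (bigD1_seq p.2) ?uW ?sub ?map_f //= eqxx big1 ?addr0 // => w.
by rewrite eq_sym => /negPf ->; rewrite mul0r.
Qed.

(** The value of any functional is a sum of coefficients times values on words, taken over one
    duplicate-free list [W] covering the words of both sides. *)
Lemma coef_eqT x y : coef x =1 coef y -> eqT x y.
Proof.
move=> exy f; pose W := undup (map snd (x ++ y)).
have uW : uniq W by apply: undup_uniq.
rewrite !(@ev_coef f _ W) //; first by apply: eq_bigr => w _; rewrite exy.
- by move=> w; rewrite mem_undup map_cat mem_cat orbC => ->.
- by move=> w; rewrite mem_undup map_cat mem_cat => ->.
Qed.

Lemma eqT_coef x y : eqT x y -> coef x =1 coef y.
Proof. by move=> exy w; rewrite !coef_ev. Qed.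

Lemma eqT_sym x y : eqT x y -> eqT y x. Proof. by move=> e f; rewrite e. Qed.

Lemma eqT_trans y x z : eqT x y -> eqT y z -> eqT x z.
Proof. by move=> e1 e2 f; rewrite e1. Qed.

Lemma eqT_cat x x' y y' : eqT x x' -> eqT y y' -> eqT (x ++ y) (x' ++ y').
Proof. by move=> e1 e2 f; rewrite !ev_cat e1 e2. Qed.

Lemma eqT_scale c x y : eqT x y -> eqT (scalel c x) (scalel c y).
Proof. by move=> e f; rewrite !ev_scale e. Qed.

Variable (X : V -> lin F V).

(** Values on words of the algebra endomorphism extending [v |-> X v]; [subst] is the endomorphism
    itself. *)
Fixpoint subst_word w : lin F V :=
  if w is v :: w' then mull (X v) (subst_word w') else oneL F V.

Definition subst x : lin F V := flatten [seq scalel p.1 (subst_word p.2) | p <- x].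

Lemma ev_subst f x : ev f (subst x) = ev (fun u => ev f (subst_word u)) x.
Proof.
by rewrite ev_flatten /ev big_map; apply: eq_bigr => p _; rewrite -/(ev f _) ev_scale.
Qed.

Lemma subst_eqT x y : eqT x y -> eqT (subst x) (subst y).
Proof. by move=> e f; rewrite !ev_subst. Qed.

Lemma subst_cat x y : subst (x ++ y) = subst x ++ subst y.
Proof. by rewrite /subst map_cat flatten_cat. Qed.

Lemma subst_scale c x : eqT (subst (scalel c x)) (scalel c (subst x)).
Proof. by move=> f; rewrite ev_subst !ev_scale ev_subst. Qed.

Lemma ev_subst_word_cat f u w :
  ev f (subst_word (u ++ w)) = ev f (mull (subst_word u) (subst_word w)).
Proof.
elim: u f => [|v u IH] f; first by rewrite ev_mull ev1 mul1r.
rewrite /= !ev_mull; apply: eq_ev => a; rewrite IH !ev_mull.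
by apply: eq_ev => c; apply: eq_ev => d; rewrite catA.
Qed.

(** Interchange of two finite sums, used because [ev_mull] always nests the right factor inside the
    left one. *)
Lemma ev_exchange (g : word V -> word V -> F) x y :
  ev (fun u => ev (g u) y) x = ev (fun w => ev (g^~ w) x) y.
Proof.
rewrite /ev; under eq_bigr => p _ do rewrite mulr_sumr.
rewrite exchange_big /=; apply: eq_bigr => q _; rewrite mulr_sumr.
by apply: eq_bigr => p _; rewrite mulrCA.
Qed.

Lemma subst_mull x y : eqT (subst (mull x y)) (mull (subst x) (subst y)).
Proof.
move=> f; rewrite ev_subst !ev_mull ev_subst; apply: eq_ev => u.
rewrite ev_exchange ev_subst; apply: eq_ev => w.
by rewrite ev_subst_word_cat ev_mull ev_exchange.
Qed.

Lemma subst_letter v : eqT (subst (letter F v)) (X v).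
Proof.
move=> f; rewrite ev_subst ev1 mul1r /= ev_mull; apply: eq_ev => u.
by rewrite ev1 mul1r cats0.
Qed.

Lemma subst_one : eqT (subst (oneL F V)) (oneL F V).
Proof. by move=> f; rewrite ev_subst ev1 mul1r. Qed.

Lemma all_subst_word (P : pred V) w :
  (forall v p, v \in w -> p \in X v -> all P p.2) -> all (fun p => all P p.2) (subst_word w).
Proof.
elim: w => [|v w IH] //= XP; apply/allP => r /allpairsP[[p q] /= [pX qw ->]] /=.
rewrite all_cat (XP v) ?mem_head //=.
by apply: (allP (IH _)) qw => u p' uw; apply: XP; rewrite inE uw orbT.
Qed.

End FreeAlgebra.

(** * Composition of substitutions *)

Section SubstComp.
Variables (F : fieldType) (V : finType).
Implicit Types (x y z : lin F V).

Lemma subst_word_comp (X Y Z : V -> lin F V) w :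
  (forall v, v \in w -> eqT (subst Y (X v)) (Z v)) ->
  eqT (subst Y (subst_word X w)) (subst_word Z w).
Proof.
elim: w => [|v w IH] XYZ /=; first exact: subst_one.
apply: eqT_trans (subst_mull _ _ _) _ => f; rewrite !ev_mull XYZ ?mem_head //.
by apply: eq_ev => u; apply: IH => v' v'w; apply: XYZ; rewrite inE v'w orbT.
Qed.

(** Letters are confined to [P] because the substitutions used later kill every letter outside
    levels 1 to [n] and can be inverted only on the others. *)
Lemma subst_comp_id (X Y : V -> lin F V) (P : pred V) x :
  (forall v, P v -> eqT (subst Y (X v)) (letter F v)) ->
  all (fun p => all P p.2) x -> eqT (subst Y (subst X x)) x.
Proof.
move=> XY /allP Px f; rewrite !ev_subst; apply: eq_in_ev => p px.
have e : eqT (subst Y (subst_word X p.2)) (subst_word (letter F (V:=V)) p.2).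
  by apply: subst_word_comp => v vp; apply: XY; apply: (allP (Px p px)).
rewrite -ev_subst e; elim: (p.2) f => [|v w IH] f /=; first by rewrite ev1 mul1r.
by rewrite ev_mull ev1 mul1r /= IH.
Qed.

End SubstComp.

(** * Closure properties of the ideal R_B *)

Section Ideal.
Variables (F : fieldType) (V : finType) (lvl : V -> nat) (E : rel V).
Implicit Types (x y z : lin F V) (f : word V -> F) (u w : word V).
Local Notation inR := (inR (F := F) lvl E).
Local Notation equivB := (equivB (F := F) lvl E).

Lemma inR_eqT x y : eqT x y -> inR x -> inR y.
Proof.
by move=> e [s [sP xs]]; exists s; split=> // w; rewrite -xs; apply/esym/eqT_coef.
Qed.

Lemma inR_nil : inR [::].
Proof. by exists [::]; split. Qed.

Lemma inR_cat x y : inR x -> inR y -> inR (x ++ y).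
Proof.
move=> [s [sP xs]] [t [tP yt]]; exists (s ++ t); split.
  by move=> r; rewrite mem_cat => /orP[/sP|/tP].
by apply: eqT_coef; rewrite map_cat flatten_cat; apply: eqT_cat; apply: coef_eqT.
Qed.

Lemma inR_flatten (s : seq (lin F V)) : (forall x, x \in s -> inR x) -> inR (flatten s).
Proof.
elim: s => [|x s IH] sR /=; first exact: inR_nil.
apply: inR_cat; first by apply: sR; rewrite mem_head.
by apply: IH => y ys; apply: sR; rewrite inE ys orbT.
Qed.

(** The outer words are absorbed into the words already surrounding each relation. *)
Lemma inR_sandwich c u w z : posw lvl u -> posw lvl w -> inR z ->
  inR (scalel c (mull (mull [:: (1, u)] z) [:: (1, w)])).
Proof.
move=> pu pw [s [sP zs]].
exists [seq (c * t.1.1.1, u ++ t.1.1.2, t.1.2, t.2 ++ w) | t <- s]; split.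
  move=> _ /mapP[t /sP[p1 r p2] ->] /=; split=> //; rewrite /posw all_cat.
    by rewrite -!/(posw _ _) pu.
  by rewrite -!/(posw _ _) pw andbT.
apply: eqT_coef => f; rewrite ev_scale ev_sandwich (coef_eqT zs) !ev_flatten !big_map mulr_sumr.
apply: eq_bigr => t _ /=; rewrite !ev_scale mulrA !ev_sandwich; congr (_ * _).
by apply: eq_ev => a; rewrite !catA.
Qed.

Lemma inR_scale c z : inR z -> inR (scalel c z).
Proof.
move=> zR; apply: inR_eqT (inR_sandwich c (u := [::]) (w := [::]) isT isT zR) => f.
by rewrite !ev_scale ev_sandwich; congr (_ * _); apply: eq_ev => u; rewrite cats0.
Qed.

Lemma inR_rel r : isRel lvl E r -> inR r.
Proof.
move=> rR; exists [:: (1, [::], r, [::])]; split.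
  by move=> t; rewrite inE => /eqP->.
apply: eqT_coef => f; rewrite /= cats0 ev_scale mul1r ev_sandwich.
by apply: eq_ev => u; rewrite cats0.
Qed.

Definition posl x := all (fun p => posw lvl p.2) x.

(** Expanding [x] and [y] into words reduces this to [inR_sandwich]. *)
Lemma inR_mull x y z : posl x -> posl y -> inR z -> inR (mull (mull x z) y).
Proof.
move=> /allP px /allP py zR.
suff : inR (flatten [seq scalel (p.1 * q.1) (mull (mull [:: (1, p.2)] z) [:: (1, q.2)])
                    | p <- x, q <- y]).
  apply: inR_eqT => f; rewrite ev_flatten big_allpairs_dep !ev_mull; apply: eq_bigr => p _.
  rewrite [in RHS]ev_exchange [ev _ y]evE mulr_sumr; apply: eq_bigr => q _.
  rewrite ev_scale ev_sandwich /= mulrA; congr (_ * _).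
  by apply: eq_ev => u; rewrite catA.
apply: inR_flatten => r /allpairsP[[p q] /= [pX qy ->]].
by apply: inR_sandwich (px p pX) (py q qy) zR.
Qed.

Lemma eqT_equivB x y : eqT x y -> equivB x y.
Proof.
move=> e; apply: inR_eqT inR_nil => f.
by rewrite ev_nil ev_cat ev_scale e mulN1r subrr.
Qed.

Lemma equivB_eqT x x' y y' : eqT x x' -> eqT y y' -> equivB x y -> equivB x' y'.
Proof. by move=> ex ey; apply: inR_eqT; apply: eqT_cat => //; apply: eqT_scale. Qed.

End Ideal.

(** * The relations as products of a vertex [v] with a function constant on S(v) *)

Section Relations.
Variables (F : fieldType) (V : finType) (lvl : V -> nat) (E : rel V).
Implicit Types (x y z : lin F V) (g : V -> F).
Local Notation inR := (inR (F := F) lvl E).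
Hypothesis lay : layered lvl E.

Definition const_on v g : Prop := forall w w', E v w -> E v w' -> g w = g w'.

(** The product of the letter [v] with the combination of vertices given by [g]; level 0 is dropped
    because only V_+ generates the algebra. *)
Definition lmul v g : lin F V := [seq (g w, [:: v; w]) | w <- enum V & (0 < lvl w)%N].

Lemma ev_lmul f v g : ev f (lmul v g) = \sum_(w | (0 < lvl w)%N) g w * f [:: v; w].
Proof. by rewrite ev_map big_enum_cond. Qed.

(** The edge words add up to the common value of [g] times the relation of [v], and every other word
    is itself a relation. *)
Lemma inR_lmul v g : (0 < lvl v)%N -> ((1 < lvl v)%N -> const_on v g) -> inR (lmul v g).
Proof.
have [lvlE hasE _] := lay => v0 gc.
have nonedges : inR (flatten [seq scalel (g w) [:: (1, [:: v; w])]
                        | w <- enum V & (0 < lvl w)%N && ~~ E v w]).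
  apply: inR_flatten => _ /mapP[w + ->]; rewrite mem_filter => /andP[/andP[w0 nE] _].
  by apply/inR_scale/inR_rel; left; exists v, w.
have ev_nonedges f : ev f (flatten [seq scalel (g w) [:: (1, [:: v; w])]
     | w <- enum V & (0 < lvl w)%N && ~~ E v w])
     = \sum_(w | (0 < lvl w)%N && ~~ E v w) g w * f [:: v; w].
  rewrite ev_flatten big_map big_filter big_enum_cond.
  by apply: eq_bigr => w _; rewrite ev_scale ev1 mul1r.
(* At level 1 all edges end at level 0, so [lmul v g] contains only non-edge words. *)
have [v1|] := ltnP 1 (lvl v); last first.
  move=> v1; apply: inR_eqT nonedges => f; rewrite ev_nonedges ev_lmul.
  apply: eq_bigl => w; case: (boolP (E v w)) => [/lvlE e|_]; rewrite ?andbT //.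
  by move: v1; rewrite e ltnS leqn0 => /eqP->.
have [w0 Ew0] := hasE v v0.
have edges : inR (scalel (g w0) [seq (1, [:: v; w]) | w <- enum [pred w | E v w]]).
  by apply/inR_scale/inR_rel; right; exists v.
apply: inR_eqT (inR_cat edges nonedges) => f.
rewrite ev_cat ev_nonedges ev_lmul [RHS](bigID (E v)) /=; congr (_ + _).
rewrite ev_scale /ev big_map big_enum mulr_sumr; apply: eq_big => [w|w Ew] /=.
  rewrite inE; case: (boolP (E v w)) => [/lvlE e|]; rewrite ?andbF // andbT.
  by move: v1; rewrite e ltnS.
by rewrite mul1r (gc v1 w0 w).
Qed.

(** A non-edge word comes from a delta function vanishing on S(v), a sum relation from the indicator
    of S(v), which is 1 there. *)
Lemma isRel_lmul r : isRel lvl E r ->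
  exists v g, [/\ (0 < lvl v)%N, const_on v g & eqT r (lmul v g)].
Proof.
have [lvlE _ _] := lay.
move=> [[v [w [v0 w0 nE ->]]]|[v [v1 ->]]].
  exists v, (fun u => (u == w)%:R); split=> //.
    move=> u u' Eu Eu'; have nEw t : E v t -> (t == w) = false.
      by move=> Et; apply: contraNF nE => /eqP<-.
    by rewrite !nEw.
  move=> f; rewrite ev1 ev_lmul (bigD1 w) //= eqxx big1 ?addr0 // => u /andP[_ /negPf->].
  by rewrite mul0r.
exists v, (fun u => (E v u)%:R); split=> //; first exact: ltnW.
  by move=> u u' -> ->.
move=> f; rewrite ev_lmul /ev big_map big_enum /= [RHS]big_mkcond [LHS]big_mkcond.
apply: eq_bigr => w _ /=; rewrite inE; case: (boolP (E v w)) => [/lvlE e|].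
  by move: v1; rewrite e ltnS => ->.
by rewrite mul0r; case: ifP.
Qed.

(** The difference of the two coefficients is a functional vanishing on every summand of an element
    of the ideal. *)
Lemma inR_edges z v w w' : inR z -> (1 < lvl v)%N -> E v w -> E v w' ->
  coef z [:: v; w] = coef z [:: v; w'].
Proof.
move=> [s [sP zs]] v1 Ew Ew'; rewrite !zs !coef_ev !ev_flatten !big_map.
apply: eq_big_seq => t /sP[_ rR _]; rewrite !ev_scale !ev_sandwich; congr (_ * _).
have [a [g [a0 ga rg]]] := isRel_lmul rR; rewrite !rg !ev_lmul.
have [lvlE _ _] := lay.
(* Relations have degree 2, so a two-letter word can occur only when both surrounding words are
   empty. *)
case: (t.1.1.2) => [|? [|? [|? ?]]]; case: (t.2) => [|? ?];
  try by rewrite !big1 // => u _; rewrite /= !eqseq_cons ?andbF ?mulr0.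
rewrite /= (bigD1 w) /=; last by move: v1; rewrite (lvlE _ _ Ew).
rewrite [RHS](bigD1 w') /=; last by move: v1; rewrite (lvlE _ _ Ew').
rewrite !big1 ?addr0.
- rewrite !eqseq_cons !eqxx !andbT; case: eqP => [e|]; last by rewrite !mulr0.
  by subst; rewrite (ga w w').
- by move=> u /andP[_ /negPf nu]; rewrite !eqseq_cons nu andbF mulr0.
- by move=> u /andP[_ /negPf nu]; rewrite !eqseq_cons nu andbF mulr0.
Qed.

(** * Level-preserving substitutions that respect the ideal *)

Variable n : nat.

Definition lowv v := (0 < lvl v <= n)%N.

(* Sending the letters outside the levels 1..n to 0 makes the substitution map the
   whole ideal R_B, not only its part below level n, into itself. *)
Definition graded_image (h : V -> V -> F) v : lin F V :=
  [seq (h v u, [:: u]) | u <- enum V & (lvl u == lvl v) && lowv v].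

Lemma ev_graded_image f h v :
  ev f (graded_image h v) = \sum_(u | (lvl u == lvl v) && lowv v) h v u * f [:: u].
Proof. by rewrite ev_map big_enum_cond. Qed.

Lemma mem_graded_image h v p : p \in graded_image h v ->
  exists u, [/\ p.2 = [:: u], lvl u = lvl v & lowv v].
Proof. by move=> /mapP[u + ->]; rewrite mem_filter => /andP[/andP[/eqP ? ?] _]; exists u. Qed.

Lemma low_subst h x : all (fun p => all lowv p.2) (subst (graded_image h) x).
Proof.
apply/allP => p /flattenP[_ /mapP[q _ ->] /mapP[r + ->]] /=.
move: r; apply/allP; apply: all_subst_word => v r _ /mem_graded_image[u [-> lu]].
by rewrite /lowv -lu /= andbT.
Qed.

Lemma pos_subst_word h w : posl lvl (subst_word (graded_image h) w).
Proof.
apply: all_subst_word => v r _ /mem_graded_image[u [-> lu /andP[v0 _]]].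
by rewrite /= lu v0.
Qed.

Section Preserve.
Variable h : V -> V -> F.
Hypothesis h_low : forall v u, (lvl v < n)%N -> h v u = (v == u)%:R.
Hypothesis h_const : forall v u g, lvl v = n -> lvl u = n -> h v u != 0 ->
  const_on v g -> const_on u g.

(** The image of [v * g] is the combination of the products [u * g'] with coefficients [h v u],
    where [g'] is the image of [g]. Below level [n] the substitution is the identity, so [g'] agrees
    with [g] on S(u). *)
Lemma subst_lmul v g : const_on v g -> inR (subst (graded_image h) (lmul v g)).
Proof.
have [lvlE _ _] := lay => gc.
have [lv|nlv] := boolP (lowv v); last first.
  apply: inR_eqT (inR_nil _ _ _) => f; rewrite ev_nil ev_subst ev_lmul big1 // => w _.
  by rewrite /= ev_mull ev_graded_image (negPf nlv) big_pred0 ?mulr0 // => u; rewrite andbF.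
pose g' u := \sum_(w | (0 < lvl w)%N && ((lvl u == lvl w) && lowv w)) g w * h w u.
have g'E u : (0 < lvl u < n)%N -> g' u = g u.
  move=> /andP[u0 un]; rewrite /g' (bigD1 u) /= /lowv ?u0 ?eqxx ?(ltnW un) //.
  rewrite h_low // eqxx mulr1 big1 ?addr0 // => w /andP[/andP[_ /andP[/eqP e _]] /negPf nwu].
  by rewrite h_low -?e // nwu mulr0.
suff : inR (flatten [seq scalel (h v u) (lmul u g') | u <- enum V & lvl u == lvl v]).
  apply: inR_eqT => f; rewrite ev_flatten big_map big_filter ev_subst ev_lmul.
  rewrite big_enum_cond /=; under eq_bigr => u _ do rewrite ev_scale ev_lmul.
  under [RHS]eq_bigr => w _.
    rewrite /= ev_mull ev_graded_image lv; under eq_bigr => u _.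
      rewrite ev_mull ev_graded_image; under eq_bigr => u' _ do rewrite ev1 mul1r cats0.
      over.
    rewrite mulr_sumr; over.
  rewrite [RHS]exchange_big /=; apply: eq_big => [u|u _]; first by rewrite andbT.
  under [RHS]eq_bigr => w _ do rewrite mulrCA.
  rewrite -mulr_sumr; congr (_ * _).
  under [LHS]eq_bigr => u' _ do rewrite /g' mulr_suml.
  under [RHS]eq_bigr => w _ do rewrite mulr_sumr.
  rewrite (exchange_big_dep (fun w => (0 < lvl w)%N)) /=; last by move=> ? ? _ /andP[].
  apply: eq_bigr => w w0; apply: eq_big => [u'|u' _]; last by rewrite mulrA.
  by rewrite w0 /=; case: eqP => [->|]; rewrite ?w0 ?andbF.
apply: inR_flatten => _ /mapP[u + ->]; rewrite mem_filter => /andP[/eqP uv _].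
have [->|hvu] := eqVneq (h v u) 0.
  by apply: inR_eqT (inR_nil _ _ _) => f; rewrite ev_nil ev_scale mul0r.
have /andP[v0 vn] := lv.
apply/inR_scale/inR_lmul; rewrite uv // => v1 w w' Ew Ew'.
have wu := lvlE _ _ Ew; have w'u := lvlE _ _ Ew'.
have low t : lvl u = (lvl t).+1 -> (0 < lvl t < n)%N.
  by move=> e; move: v1 vn; rewrite -uv e !ltnS => -> ->.
(* At level [n] constancy passes from [v] to [u] by [h_const]; below it, [h v u != 0] forces
   [u = v]. *)
rewrite !g'E ?low //; move: vn; rewrite leq_eqVlt => /orP[/eqP vn|vn].
  by apply: (h_const _ _ hvu gc); rewrite ?uv.
have vu : v = u by apply/eqP; apply: contraNT hvu => /negPf nvu; rewrite h_low // nvu.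
by subst u; apply: gc.
Qed.

(** By multiplicativity each summand becomes the image of a relation, covered by [subst_lmul],
    between images of words, whose letters all have positive level. *)
Lemma subst_inR z : inR z -> inR (subst (graded_image h) z).
Proof.
move=> [s [sP /coef_eqT zs]]; apply: inR_eqT (eqT_sym (subst_eqT _ zs)) _.
suff : inR (flatten [seq subst (graded_image h) (scalel t.1.1.1
         (mull (mull [:: (1, t.1.1.2)] t.1.2) [:: (1, t.2)])) | t <- s]).
  by apply: inR_eqT => f; rewrite ev_subst !ev_flatten !big_map; apply: eq_bigr => t _; rewrite ev_subst.
apply: inR_flatten => _ /mapP[t ts ->].
have [_ rR _] := sP t ts; have [v [g [_ gc rg]]] := isRel_lmul rR.
apply: inR_eqT (eqT_sym (subst_scale _ _ _)) _; apply: inR_scale.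
have := inR_mull (pos_subst_word h t.1.1.2) (pos_subst_word h t.2) (subst_lmul gc).
apply: inR_eqT => f; rewrite ev_subst ev_sandwich !ev_mull.
under [RHS]eq_ev => a do rewrite ev_subst_word_cat ev_mull.
rewrite [RHS]ev_exchange; apply: eq_ev => a.
rewrite ev_subst -rg; apply: eq_ev => c.
by rewrite ev_subst_word_cat ev_mull; apply: eq_ev => d; apply: eq_ev => e; rewrite catA.
Qed.

Lemma subst_equivB x y : equivB lvl E x y ->
  equivB lvl E (subst (graded_image h) x) (subst (graded_image h) y).
Proof.
move=> /subst_inR; apply: inR_eqT; rewrite subst_cat; apply: eqT_cat => //.
exact: subst_scale.
Qed.

End Preserve.

Lemma graded_image_comp h h' v :
  (forall v u, lowv v -> lvl u = lvl v ->
     \sum_(t | lvl t == lvl v) h v t * h' t u = (v == u)%:R) -> lowv v ->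
  eqT (subst (graded_image h') (graded_image h v)) (letter F v).
Proof.
move=> hh' lv f; rewrite ev_subst ev_graded_image ev1 mul1r lv.
under eq_bigl => t do rewrite andbT.
under eq_bigr => t /eqP tv.
  rewrite /= ev_mull ev_graded_image /lowv tv -/(lowv v) lv mulr_sumr.
  under eq_bigr => u _ do rewrite ev1 mul1r cats0 mulrA.
  under eq_bigl => u do rewrite andbT.
  over.
rewrite exchange_big /= (bigD1 v) //= -mulr_suml hh' // eqxx mul1r big1 ?addr0 //.
move=> u /andP[/eqP uv /negPf nuv]; rewrite -mulr_suml hh' //.
by rewrite eq_sym nuv mul0r.
Qed.

Lemma homog_subst h m k x : homog lvl m k x ->
  homog lvl m k (subst (graded_image h) x).
Proof.
move=> /allP hx; apply/allP => p /flattenP[_ /mapP[q qx ->] /mapP[r + ->]] /=.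
have /andP[/eqP <- /eqP <-] := hx q qx.
elim: (q.2) r => [|v w IH] r /=; first by rewrite inE => /eqP->.
move=> /allpairsP[[p1 p2] /= [/mem_graded_image[u [-> lu _]] /IH/andP[/eqP sz /eqP sm] ->]] /=.
by rewrite sz lu sm !eqxx.
Qed.

(** The substitution along [h'] also respects the ideal and is a two-sided inverse on the letters of
    levels 1 to [n]; this gives injectivity and surjectivity. *)
Lemma graded_aut_subst h h' :
  (forall v u, (lvl v < n)%N -> h v u = (v == u)%:R) ->
  (forall v u, (lvl v < n)%N -> h' v u = (v == u)%:R) ->
  (forall v u g, lvl v = n -> lvl u = n -> h v u != 0 -> const_on v g -> const_on u g) ->
  (forall v u g, lvl v = n -> lvl u = n -> h' v u != 0 -> const_on v g -> const_on u g) ->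
  (forall v u, lvl v = n -> lvl u = n ->
     \sum_(t | lvl t == n) h v t * h' t u = (v == u)%:R) ->
  (forall v u, lvl v = n -> lvl u = n ->
     \sum_(t | lvl t == n) h' v t * h t u = (v == u)%:R) ->
  graded_aut lvl E n (subst (graded_image h)).
Proof.
move=> hl h'l hc h'c hh' h'h.
have inv k k' : (forall v u, (lvl v < n)%N -> k v u = (v == u)%:R) ->
  (forall v u, (lvl v < n)%N -> k' v u = (v == u)%:R) ->
  (forall v u, lvl v = n -> lvl u = n ->
     \sum_(t | lvl t == n) k v t * k' t u = (v == u)%:R) ->
  forall x, lowl lvl n x -> eqT (subst (graded_image k') (subst (graded_image k) x)) x.
  move=> kl k'l kk' x; apply: subst_comp_id => v lv; apply: graded_image_comp (lv) => {lv}v u lv uv.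
  (* At level [n] the two matrices are inverse to each other; below it both are the identity. *)
  have /andP[_] := lv; rewrite leq_eqVlt => /orP[/eqP vn|vn].
    by rewrite vn kk' // uv.
  rewrite (bigD1 v) //= kl // eqxx mul1r k'l // big1 ?addr0 // => t /andP[_ /negPf nt].
  by rewrite kl // eq_sym nt mul0r.
split.
- by move=> x _; apply: low_subst.
- by move=> x y _ _; apply: subst_equivB.
- by move=> x y _ _; rewrite subst_cat; apply: eqT_equivB.
- by move=> c x _; apply/eqT_equivB/subst_scale.
- by move=> x y _ _; apply/eqT_equivB/subst_mull.
- exact/eqT_equivB/subst_one.
- move=> m k x lx hx; exists (subst (graded_image h) x); split=> //; first exact: low_subst.
    exact: homog_subst hx.
  exact: eqT_equivB.
- move=> x y lx ly /(subst_equivB h'l h'c); apply: equivB_eqT; exact: inv.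
- move=> y ly; exists (subst (graded_image h') y); split; first exact: low_subst.
  exact/eqT_equivB/inv.
Qed.

End Relations.

(** * Transversals and inverses of invertible matrices *)

Section Matrices.
Variables (F : fieldType) (N : nat).
Implicit Types (M : 'M[F]_N).

(** Otherwise every term of the Leibniz expansion of the determinant has a zero factor. *)
Lemma unitmx_transversal M : M \in unitmx -> exists s : 'S_N, forall i, M i (s i) != 0.
Proof.
rewrite unitmxE unitfE => detM.
have [/existsP[s /forallP Ms]|/existsPn noM] := boolP [exists s : 'S_N, [forall i, M i (s i) != 0]].
  by exists s.
case/eqP: detM; rewrite /determinant big1 // => s _.
have /forallPn[i /negPn/eqP Mi] := noM s.
by rewrite (bigD1 i) //= Mi mul0r mulr0.
Qed.

(* M stabilises the span of the e_k with r i k, so, being invertible, it maps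
   that span onto itself, and invmx M stabilises it too. *)
Lemma invmx_pattern M (r : rel 'I_N) : M \in unitmx -> reflexive r -> transitive r ->
  (forall i j, M i j != 0 -> r i j) -> forall i j, invmx M i j != 0 -> r i j.
Proof.
move=> uM rr rt Mr i j; pose W : 'M[F]_N := diag_mx (\row_k (r i k)%:R).
have sWM : (W *m M <= W)%MS.
  suff -> : W *m M = W *m M *m W by apply: submxMl.
  apply/matrixP => k l; rewrite mul_mx_diag mul_diag_mx !mxE.
  case: (boolP (r i k)) => rik; last by rewrite !mul0r.
  have [->|Mkl] := eqVneq (M k l) 0; first by rewrite mulr0 mul0r.
  by rewrite (rt _ _ _ rik (Mr _ _ Mkl)) mulr1.
have sWM' : (W <= W *m M)%MS.
  by rewrite -(geq_leqif (mxrank_leqif_sup sWM)) mxrankMfree // row_free_unit.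
have /submxP[D WD] : (W *m invmx M <= W)%MS.
  by rewrite -{2}[W](mulmxK uM) submxMr.
apply: contraNT => rij; have := congr1 (fun A : 'M_N => A i j) WD.
by rewrite mul_mx_diag mul_diag_mx !mxE rr mul1r (negPf rij) mulr0 => ->.
Qed.

End Matrices.

(** * The kernels kappa_a as subspaces *)

Section Kappa.
Variables (F : fieldType) (V : finType) (lvl : V -> nat) (E : rel V) (n : nat).
Hypothesis lay : layered lvl E.
Hypothesis n2 : (2 <= n)%N.
Local Notation Fun := {ffun V -> F^o}.
Implicit Types (a g : {ffun V -> F}).

Lemma ev_linv (f : word V -> F) g : ev f (linv g) = \sum_v g v * f [:: v].
Proof. by rewrite /ev big_map big_enum. Qed.

Lemma ev_mull_linv (f : word V -> F) a g :
  ev f (mull (linv a) (linv g)) = \sum_v a v * \sum_w g w * f [:: v; w].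
Proof. by rewrite ev_mull ev_linv; apply: eq_bigr => v _; rewrite ev_linv. Qed.

(** Forwards, the coefficient of the word [v u] in the product is [a v * g u], and [inR_edges]
    compares these along the edges from [v]. Backwards, the product is the sum of the [a v] times
    [lmul v g]. *)
Lemma kappaE a g : inBk lvl n a ->
  kappa lvl E n a g <-> inBk lvl n.-1 g /\ forall v, a v != 0 -> const_on E v g.
Proof.
move=> Ba; split=> -[Bg]; [move=> agR | move=> gc]; split=> //.
  move=> v av w w' Ew Ew'; apply: (mulfI av).
  have vn : lvl v = n by apply/eqP; apply: contraNT av => /Ba ->.
  have cE u : coef (mull (linv a) (linv g)) [:: v; u] = a v * g u.
    rewrite coef_ev ev_mull_linv (bigD1 v) //= [X in _ + X]big1 ?addr0.
      rewrite (bigD1 u) //= eqxx mulr1 big1 ?addr0 // => t /negPf nt.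
      by rewrite !eqseq_cons nt andbF mulr0.
    by move=> t /negPf nt; rewrite big1 ?mulr0 // => t' _; rewrite eqseq_cons nt mulr0.
  by rewrite -!cE; apply: (inR_edges lay agR); rewrite ?vn.
have : inR lvl E (flatten [seq scalel (a v) (lmul lvl v g) | v <- enum V]).
  apply: inR_flatten => _ /mapP[v _ ->].
  have [->|av] := eqVneq (a v) 0.
    by apply: inR_eqT (inR_nil _ _ _) => f; rewrite ev_nil ev_scale mul0r.
  have vn : lvl v = n by apply/eqP; apply: contraNT av => /Ba ->.
  by apply/inR_scale/(inR_lmul lay); rewrite vn ?(ltnW n2) // => _; apply: gc.
apply: inR_eqT => f; rewrite ev_flatten big_map big_enum ev_mull_linv /=.
apply: eq_bigr => v _; rewrite ev_scale ev_lmul big_mkcond; congr (_ * _).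
(* Since [n >= 2], level 0 differs from level [n.-1], so [g] vanishes on the vertices dropped by
   [lmul]. *)
apply: eq_bigr => w _; case: posnP => // w0; rewrite Bg ?mul0r // w0.
by case: n n2 => [|[]].
Qed.

(** A linear map whose kernel encodes constancy on S(v) for all [v] in the support of [a]; the
    codomain is indexed by all triples, with 0 where there is no condition. *)
Definition edge_defect a (g : Fun) : {ffun V * V * V -> F^o} :=
  [ffun t => if [&& a t.1.1 != 0, E t.1.1 t.1.2 & E t.1.1 t.2] then g t.1.2 - g t.2 else 0].

Lemma edge_defect_linear a : linear (edge_defect a).
Proof.
move=> c g g'; apply/ffunP => t; rewrite !ffunE; case: ifP => _; last by rewrite scaler0 addr0.
by rewrite scalerBr opprD addrACA.
Qed.

HB.instance Definition _ a := GRing.isLinear.Build F Fun _ _ _ (edge_defect_linear a).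

Definition off_level (g : Fun) : Fun := [ffun v => if lvl v != n.-1 then g v else 0].

Lemma off_level_linear : linear off_level.
Proof.
by move=> c g g'; apply/ffunP => t; rewrite !ffunE; case: ifP => _; rewrite ?scaler0 ?addr0.
Qed.

HB.instance Definition _ := GRing.isLinear.Build F Fun _ _ _ off_level_linear.

(** This is kappa_a for [a] in B_n, by [kappaE] and [mem_kspace]; [off_level] cuts out B_{n-1}. *)
Definition kspace a : {vspace Fun} :=
  (lker (linfun off_level) :&: lker (linfun (edge_defect a)))%VS.

Lemma mem_kspace a (g : Fun) :
  g \in kspace a <-> inBk lvl n.-1 g /\ forall v, a v != 0 -> const_on E v g.
Proof.
rewrite memv_cap !memv_ker !lfunE /=; split.
  case/andP=> /eqP/ffunP g0 /eqP/ffunP g1; split=> [v nv|v av w w' Ew Ew'].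
    by have := g0 v; rewrite !ffunE nv.
  by have := g1 (v, w, w'); rewrite !ffunE /= av Ew Ew' => /eqP; rewrite subr_eq0 => /eqP.
case=> g0 g1; apply/andP; split; apply/eqP/ffunP => t; rewrite !ffunE; case: ifP => //.
  exact: g0.
by case/and3P=> av Ew Ew'; rewrite (g1 _ av _ _ Ew Ew') subrr.
Qed.

(** The comparison of independent families is applied to a basis of [kspace a']; the family it
    returns is free in [kspace a]. *)
Lemma kdim_dim a a' : inBk lvl n a -> inBk lvl n a' -> kdim_ge lvl E n a a' ->
  (\dim (kspace a') <= \dim (kspace a))%N.
Proof.
move=> Ba Ba' kd; set d := \dim _; pose X := vbasis (kspace a').
have [||Y [Yk Yi]] := kd d (fun i => X`_i).
- move=> i; apply/kappaE => //; apply/mem_kspace/vbasis_mem/mem_nth.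
  by rewrite size_tuple.
- move=> c c0; move/freeP: (basis_free (vbasisP (kspace a'))); apply.
  apply/ffunP => v; rewrite sum_ffunE ffunE -[RHS](c0 v).
  by apply: eq_bigr => i _; rewrite ffunE.
pose Z : d.-tuple Fun := [tuple (Y i : Fun) | i < d].
have fZ : free Z.
  apply/freeP => c /ffunP c0; apply: Yi => v; have := c0 v; rewrite sum_ffunE ffunE => e0.
  rewrite -[RHS]e0.
  by apply: eq_bigr => i _; rewrite ffunE -tnth_nth tnth_mktuple.
rewrite -(size_tuple Z); move: fZ; rewrite /free => /eqP <-.
apply/dimvS/span_subvP => _ /mapP[i _ ->].
by apply/mem_kspace/kappaE.
Qed.

Lemma kspace_indicator_const v u (g : V -> F) : lvl v = n -> lvl u = n ->
  (kspace (indicator F v) <= kspace (indicator F u))%VS -> const_on E v g -> const_on E u g.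
Proof.
have [lvlE _ _] := lay => vn un /subvP sub gc.
(* An arbitrary [g] is truncated to level [n.-1] so as to lie in B_{n-1}; its values on S(v) and
   S(u) do not change. *)
pose g' : Fun := [ffun w => if lvl w == n.-1 then g w else 0].
have g'E t w : lvl t = n -> E t w -> g' w = g w.
  by move=> tn /lvlE tw; rewrite ffunE -tn tw eqxx.
have /sub/mem_kspace[_] : g' \in kspace (indicator F v).
  apply/mem_kspace; split=> [w /negPf nw|t]; first by rewrite ffunE nw.
  rewrite ffunE; case: (eqVneq t v) => [-> _|_]; last by rewrite eqxx.
  by move=> w w' Ew Ew'; rewrite !(g'E v) //; apply: gc.
move=> /(_ u); rewrite ffunE eqxx oner_eq0 => /(_ isT) gu w w' Ew Ew'.
by rewrite -!(g'E u) //; apply: gu.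
Qed.

Lemma kspace_support a v : a v != 0 -> (kspace a <= kspace (indicator F v))%VS.
Proof.
move=> av; apply/subvP => g /mem_kspace[Bg gc]; apply/mem_kspace; split=> // u.
by rewrite ffunE; case: (eqVneq u v) => [-> _|_]; [apply: gc | rewrite eqxx].
Qed.

End Kappa.

(** * Matching the basis with the vertices of level [n] *)

Section Matching.
Variables (F : fieldType) (V : finType) (lvl : V -> nat) (E : rel V) (n : nat).
Local Notation A := [pred v | lvl v == n].
Local Notation N := #|A|.
Variable b : 'I_N -> {ffun V -> F}.
Hypothesis lay : layered lvl E.
Hypothesis n2 : (2 <= n)%N.
Hypothesis basis_b : is_basis lvl n b.
Hypothesis greedy : forall (i : 'I_N) (a : V), lvl a = n ->
  ~ in_span_prefix b i (indicator F a) -> kdim_ge lvl E n (b i) (indicator F a).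

Local Notation e := (@enum_val V A).
Local Notation K a := (kspace lvl E n a).

Let M : 'M[F]_N := \matrix_(i, j) b i (e j).

Lemma lvl_enum_val k : lvl (e k) = n.
Proof. by apply/eqP; have := enum_valP k. Qed.

Lemma inBk_indicator k : inBk lvl n (indicator F (e k)).
Proof. by move=> v nv; rewrite ffunE; case: (eqVneq v (e k)) nv => // ->; rewrite lvl_enum_val eqxx. Qed.

(** Expressing the vertices through the spanning family [b] gives a left inverse of [M]. *)
Lemma basis_unitmx : M \in unitmx.
Proof.
have [_ _ gen] := basis_b.
have /fin_all_exists[c cP] k : exists c : 'I_N -> F,
    forall v, indicator F (e k) v = \sum_(i < N) c i * b i v.
  exact/gen/inBk_indicator.
have CM : (\matrix_(k, i) c k i) *m M = 1%:M.
  apply/matrixP => k l; rewrite !mxE; under eq_bigr => i _ do rewrite !mxE.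
  by rewrite -cP ffunE (inj_eq enum_val_inj) eq_sym.
by case/mulmx1_unit: CM.
Qed.

(** Row [k] of [invmx M] holds the coordinates of the vertex [e k] in the basis [b]. If that vertex
    lay in the span of the members before [j], uniqueness of coordinates would make entry [j]
    zero. *)
Lemma invmx_span_prefix k j :
  invmx M k j != 0 -> ~ in_span_prefix b j (indicator F (e k)).
Proof.
move=> Ckj [c cP]; case/eqP: Ckj; pose r : 'rV[F]_N := \row_i (if (i < j)%N then c i else 0).
have rM : r *m M = delta_mx 0 k.
  apply/matrixP => i l; rewrite ord1 !mxE; have := cP (e l).
  rewrite ffunE (inj_eq enum_val_inj) /= => ->; rewrite [RHS]big_mkcond; apply: eq_bigr => t _.
  by rewrite !mxE; case: ifP; rewrite ?mul0r.
have := congr1 (fun B => (B *m invmx M) 0 j) rM.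
by rewrite mulmxK ?basis_unitmx // -rowE !mxE ltnn => <-.
Qed.

(* Two transversals, one in M and one in its inverse, squeeze the sum of the
   dim K(b i) against the sum of the dim K(v), forcing equality in every term. *)
Lemma matching : exists s : 'S_N, forall i, K (b i) = K (indicator F (e (s i))).
Proof.
have [Bb _ _] := basis_b.
have [s sP] := unitmx_transversal basis_unitmx.
have [t tP] : exists t : 'S_N, forall i, invmx M i (t i) != 0.
  by apply: unitmx_transversal; rewrite unitmx_inv basis_unitmx.
pose d k := \dim (K (indicator F (e k))).
have sub i : (K (b i) <= K (indicator F (e (s i))))%VS.
  by apply: kspace_support; have := sP i; rewrite mxE.
have ub i : (\dim (K (b i)) <= d (s i) ?= iff (K (b i) == K (indicator F (e (s i)))))%N.
  exact: dimv_leqif_eq.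
have lb i : (d i <= \dim (K (b (t i))))%N.
  apply: kdim_dim => //; first exact: inBk_indicator.
  by apply: greedy; [apply: lvl_enum_val | apply: invmx_span_prefix].
have [le eqs] := leqif_sum (fun i (_ : true) => ub i).
have ge : (\sum_i d (s i) <= \sum_i \dim (K (b i)))%N.
  rewrite -(reindex_inj (P := predT) (F := d) (@perm_inj _ s)).
  by rewrite [X in (_ <= X)%N](reindex_inj (@perm_inj _ t)) leq_sum.
exists s => i; apply/eqP; move: eqs; rewrite eqn_leq le ge => /esym/forallP/(_ i).
by [].
Qed.

(** * The automorphism built from the matching *)

(** [Q] on level [n] and the identity elsewhere. The sums have at most one term each and give 0 when
    [v] has level [n] and [u] does not. *)
Definition lift_matrix (Q : 'M[F]_N) (v u : V) : F :=
  if lvl v == n then \sum_(k | e k == v) \sum_(l | e l == u) Q k l else (v == u)%:R.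

Lemma lift_matrixE Q k l : lift_matrix Q (e k) (e l) = Q k l.
Proof.
rewrite /lift_matrix lvl_enum_val eqxx (big_pred1 k) ?(big_pred1 l) // => i;
  exact: (inj_eq enum_val_inj).
Qed.

Lemma lift_matrix_low Q v u : (lvl v < n)%N -> lift_matrix Q v u = (v == u)%:R.
Proof. by rewrite /lift_matrix ltn_neqAle => /andP[/negPf->]. Qed.

Lemma enum_val_surj v : lvl v = n -> exists k, v = e k.
Proof.
move=> /eqP vn; have vA : v \in A by [].
by exists (enum_rank_in vA v); rewrite enum_rankK_in.
Qed.

Lemma lift_matrix_mul P Q v u : P *m Q = 1%:M -> lvl v = n -> lvl u = n ->
  \sum_(t | lvl t == n) lift_matrix P v t * lift_matrix Q t u = (v == u)%:R.
Proof.
move=> PQ /enum_val_surj[k ->] /enum_val_surj[l ->].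
rewrite (big_enum_val (A := A)) /=; under eq_bigr => i _ do rewrite !lift_matrixE.
have := congr1 (fun B : 'M_N => B k l) PQ; rewrite !mxE => ->.
by rewrite (inj_eq enum_val_inj).
Qed.

Lemma greedy_upper_vertex_like : upper_vertex_like lvl E n b.
Proof.
have [Bb _ _] := basis_b.
have [s sP] := matching.
(* Permuting rows by the matching makes row [s i] list the coordinates of [b i], the intended image
   of the vertex [e (s i)]. *)
pose Q : 'M[F]_N := row_perm (s^-1)%g M.
have QE k l : Q k l = b ((s^-1)%g k) (e l) by rewrite !mxE.
have uQ : Q \in unitmx.
  by rewrite /Q row_permE unitmx_mul unitmx_perm basis_unitmx.
(* The preorder on level [n] given by inclusion of kernels. A nonzero entry of [Q] respects it,
   since the kernel of a basis member equals that of its matched vertex and lies in that of each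
   vertex in its support. *)
pose r : rel 'I_N := fun k l => (K (indicator F (e k)) <= K (indicator F (e l)))%VS.
have Qr k l : Q k l != 0 -> r k l.
  by rewrite QE /r => /(kspace_support lvl E n); rewrite sP permKV.
have Q'r : forall k l, invmx Q k l != 0 -> r k l.
  apply: invmx_pattern => // [k|l k m]; [exact: subvv | exact: subv_trans].
(* Inclusion of kernels is exactly what transfers constancy, so this serves for both [Q] and its
   inverse. *)
have lift_const (P : 'M[F]_N) v u (g : V -> F) : (forall k l, P k l != 0 -> r k l) -> lvl v = n -> lvl u = n ->
    lift_matrix P v u != 0 -> const_on E v g -> const_on E u g.
  move=> Pr vn un; have [k ek] := enum_val_surj vn; have [l el] := enum_val_surj un.
  rewrite {1}ek {1}el lift_matrixE => /Pr; rewrite /r -ek -el.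
  exact: kspace_indicator_const.
have image_top (k : 'I_N) : eqT (subst (graded_image lvl n (lift_matrix Q)) (letter F (e k)))
                       (linv (b ((s^-1)%g k))).
  move=> f; rewrite subst_letter ev_graded_image ev_linv /lowv lvl_enum_val leqnn (ltnW n2) /=.
  rewrite big_mkcond; apply: eq_bigr => u _; rewrite andbT.
  case: eqVneq => [/enum_val_surj[l ->]|nu]; first by rewrite lift_matrixE QE.
  by rewrite Bb ?mul0r.
exists (subst (graded_image lvl n (lift_matrix Q))); split.
- apply: (graded_aut_subst lay (h' := lift_matrix (invmx Q))).
  + by move=> *; apply: lift_matrix_low.
  + by move=> *; apply: lift_matrix_low.
  + by move=> v u g; apply: lift_const.
  + by move=> v u g; apply: lift_const.
  + by move=> v u; apply: lift_matrix_mul; rewrite mulmxV.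
  + by move=> v u; apply: lift_matrix_mul; rewrite mulVmx.
- move=> v v0 vn; apply: eqT_equivB => f; rewrite subst_letter ev_graded_image ev1 mul1r.
  rewrite (bigD1 v) /=; last by rewrite eqxx /lowv v0 ltnW.
  rewrite lift_matrix_low // eqxx mul1r big1 ?addr0 // => u /andP[_ /negPf nu].
  by rewrite lift_matrix_low // eq_sym nu mul0r.
- move=> v /enum_val_surj[k ->]; exists ((s^-1)%g k); exact: eqT_equivB.
- move=> i; exists (e (s i)); split; first exact: lvl_enum_val.
  by have := image_top (s i); rewrite permK; apply: eqT_equivB.
Qed.

End Matching.

Theorem mainTheorem14 (F : fieldType) (V : finType) (lvl : V -> nat) (E : rel V)
  (n N : nat) (b : 'I_N -> {ffun V -> F}) :
  layered lvl E -> uniform lvl E -> (2 <= n)%N ->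
  N = #|[pred v | lvl v == n]| ->
  is_basis lvl n b ->
  (forall (i : 'I_N) (a : V), lvl a = n ->
     ~ in_span_prefix b i (indicator F a) ->
     kdim_ge lvl E n (b i) (indicator F a)) ->
  upper_vertex_like lvl E n b.
Proof. by move=> lay _ n2 eN; subst N; apply: greedy_upper_vertex_like. Qed.
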